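(* Let $B$ be an integral domain containing a field $\mathbf{k}$ of characteristic zero, $S\subseteq B\setminus\{0\}$ a multiplicative set, $G$ a totally ordered abelian group, $\mathrm{DEG} : S^{-1}B\to G\cup\{-\infty\}$ a degree function and $\deg : B\to G\cup\{-\infty\}$ the restriction of $\mathrm{DEG}$. If $\mathrm{DEG}$ is tame over $\mathbf{k}$ then so is $\deg$.
   Context: A degree function on a ring $B$ with values in a totally ordered abelian group $G$ is a map $\deg : B \to G\cup\{-\infty\}$ such that for all $x,y\in B$: (1) $\deg(x)=-\infty$ iff $x=0$; (2) $\deg(xy)=\deg x+\deg y$; (3) $\deg(x+y)\le\max(\deg x,\deg y)$. For a derivation $D:B\to B$ of an integral domain $B$ with degree function $\deg$, let $U=\{\deg(Dx)-\deg(x) : x\in B\setminus\{0\}\}\subseteq G\cup\{-\infty\}$. If $U$ has a greatest element, $\deg(D)$ is defined to be that element; otherwise $\deg(D)$ is not defined. For $A\subseteq B$ integral domains of characteristic zero, $\deg$ is tame over $A$ if $\deg(D)$ is defined for all $A$-derivations $D:B\to B$. *)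

(* Defs.v *)
From HB Require Import structures.
From mathcomp Require Import all_boot all_order all_algebra.
From mathcomp Require Import boolp classical_sets.

Set Implicit Arguments.
Unset Strict Implicit.
Unset Printing Implicit Defensive.

Import Order.TTheory GRing.Theory Num.Theory.

Local Open Scope ring_scope.

(* MathComp's porderZmodType is merely an abelian group with an unrelated
   partial order. *)
HB.mixin Record isOrderedGroup G of Num.POrderedZmodule G := {
  ogroup_le_total : total (<=%R : rel G);
  ogroup_leD2r : forall z x y : G, x <= y -> x + z <= y + z
}.

#[short(type="orderedGroupType")]
HB.structure Definition OrderedGroup :=
  { G of Num.POrderedZmodule G & isOrderedGroup G }.

Variant adjoin_ninf (G : Type) := NInf | Fin of G.
Arguments NInf {G}.

Section AdjoinNInf.
Variable G : orderedGroupType.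
Implicit Types u v : adjoin_ninf G.

Definition le_ninf u v : bool :=
  match u, v with
  | NInf, _ => true
  | Fin _, NInf => false
  | Fin a, Fin b => a <= b
  end.

Definition max_ninf u v := if le_ninf u v then v else u.

Definition add_ninf u v :=
  match u, v with
  | Fin a, Fin b => Fin (a + b)
  | _, _ => NInf
  end.

(* Only meaningful when v is finite; the value NInf for v = NInf is junk. *)
Definition sub_ninf u v :=
  match u, v with
  | Fin a, Fin b => Fin (a - b)
  | _, _ => NInf
  end.

End AdjoinNInf.

Definition degree_function (B : nzRingType) (G : orderedGroupType)
    (deg : B -> adjoin_ninf G) : Prop :=
  [/\ forall x, deg x = NInf <-> x = 0,
      forall x y, deg (x * y) = add_ninf (deg x) (deg y)
    & forall x y, le_ninf (deg (x + y)) (max_ninf (deg x) (deg y))].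

Definition derivation (B : nzRingType) (D : B -> B) : Prop :=
  (forall x y, D (x + y) = D x + D y) /\
  (forall x y, D (x * y) = D x * y + x * D y).

(* The inclusion of A in B is given by the morphism i. *)
Definition derivation_over (A B : nzRingType) (i : A -> B) (D : B -> B) : Prop :=
  derivation D /\ forall a, D (i a) = 0.

Section DegreeOfDerivation.
Variables (B : idomainType) (G : orderedGroupType) (deg : B -> adjoin_ninf G).

Definition degree_shifts (D : B -> B) : set (adjoin_ninf G) :=
  [set u | exists2 x, x != 0 & u = sub_ninf (deg (D x)) (deg x)]%classic.

Definition is_degree_of (D : B -> B) (d : adjoin_ninf G) : Prop :=
  degree_shifts D d /\ forall u, degree_shifts D u -> le_ninf u d.

Definition degree_defined (D : B -> B) : Prop := exists d, is_degree_of D d.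

Definition tame_over (A : idomainType) (i : {rmorphism A -> B}) : Prop :=
  forall D : B -> B, derivation_over i D -> degree_defined D.

End DegreeOfDerivation.

Record mult_set (B : idomainType) := MultSet {
  mult_set_carrier :> B -> Prop;
  mult_set1 : mult_set_carrier 1;
  mult_setM : forall x y, mult_set_carrier x -> mult_set_carrier y ->
                mult_set_carrier (x * y);
  mult_setN0 : ~ mult_set_carrier 0
}.

(* The localization of B at S is realized inside the fraction field of B, as
   the subring of the fractions whose denominator can be chosen in S. *)
Section Localization.
Variables (B : idomainType) (S : mult_set B).

Definition loc_pred : {pred {fraction B}} :=
  fun z => `[< exists b s, S s /\ z = tofrac b / tofrac s >].

Lemma loc_predP z :
  reflect (exists b s, S s /\ z = tofrac b / tofrac s) (z \in loc_pred).
Proof. exact: asboolP. Qed.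

Lemma mult_set_neq0 s : S s -> tofrac s != 0.
Proof.
move=> Ss; rewrite tofrac_eq0; apply/eqP => s0.
by apply: (@mult_setN0 _ S); rewrite -s0.
Qed.

Lemma loc_tofrac b : tofrac b \in loc_pred.
Proof.
apply/loc_predP; exists b, 1; split; first exact: mult_set1.
by rewrite rmorph1 divr1.
Qed.

Lemma loc_subring : subring_closed loc_pred.
Proof.
split.
- by rewrite -(rmorph1 (@tofrac B)) loc_tofrac.
- move=> _ _ /loc_predP[a [s [Ss ->]]] /loc_predP[b [t [St ->]]].
  apply/loc_predP; exists (a * t - b * s), (s * t).
  split; first exact: mult_setM.
  rewrite -mulNr addf_div ?mult_set_neq0//.
  by rewrite rmorphB !rmorphM mulNr.
- move=> _ _ /loc_predP[a [s [Ss ->]]] /loc_predP[b [t [St ->]]].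
  apply/loc_predP; exists (a * b), (s * t).
  split; first exact: mult_setM.
  by rewrite !rmorphM mulf_div.
Qed.

HB.instance Definition _ :=
  GRing.isSubringClosed.Build {fraction B} loc_pred loc_subring.

Record localization := Loc { loc_val : {fraction B}; _ : loc_val \in loc_pred }.

HB.instance Definition _ := [isSub for loc_val].
HB.instance Definition _ := [Choice of localization by <:].
HB.instance Definition _ := [SubChoice_isSubComNzRing of localization by <:].

Definition loc_unit : {pred localization} :=
  fun x => (val x != 0) && ((val x)^-1 \in loc_pred).

Definition loc_inv (x : localization) : localization := insubd x (val x)^-1.

Lemma loc_mulVx : {in loc_unit, left_inverse 1 loc_inv *%R}.
Proof.
move=> x /andP[x0 xV]; apply: val_inj.
by rewrite rmorphM rmorph1 /= /loc_inv val_insubd xV mulVf.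
Qed.

Lemma loc_unitPl x y : y * x = 1 -> x \in loc_unit.
Proof.
move=> /(congr1 val); rewrite rmorphM rmorph1 /= => yx1.
have x0 : val x != 0.
  by apply: contra_eq_neq yx1 => ->; rewrite mulr0 eq_sym oner_neq0.
apply/andP; split=> //.
have -> : (val x)^-1 = val y by apply: (mulIf x0); rewrite mulVf.
exact: valP.
Qed.

Lemma loc_inv_out : {in [predC loc_unit], loc_inv =1 id}.
Proof.
move=> x; rewrite inE negb_and negbK => /orP[/eqP x0|xV]; apply: val_inj.
  by rewrite /loc_inv val_insubd x0 invr0; case: ifP.
by rewrite /loc_inv val_insubd (negbTE xV).
Qed.

HB.instance Definition _ := GRing.ComNzRing_hasMulInverse.Build localization
  loc_mulVx loc_unitPl loc_inv_out.

Lemma loc_mulf_eq0 (x y : localization) : x * y = 0 -> (x == 0) || (y == 0).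
Proof.
move=> /(congr1 val); rewrite rmorphM rmorph0 /= => /eqP.
by rewrite mulf_eq0 -!(inj_eq val_inj) !rmorph0.
Qed.

HB.instance Definition _ :=
  GRing.ComUnitRing_isIntegral.Build localization loc_mulf_eq0.

Definition to_loc (b : B) : localization := Loc (loc_tofrac b).

Lemma to_loc_is_zmod_morphism : zmod_morphism to_loc.
Proof. by move=> x y; apply: val_inj; rewrite [RHS]raddfB /= raddfB. Qed.

Lemma to_loc_is_monoid_morphism : monoid_morphism to_loc.
Proof.
split; first by apply: val_inj; rewrite [RHS]rmorph1 /= rmorph1.
by move=> x y; apply: val_inj; rewrite [RHS]rmorphM /= rmorphM.
Qed.

HB.instance Definition _ :=
  GRing.isZmodMorphism.Build B localization to_loc to_loc_is_zmod_morphism.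
HB.instance Definition _ :=
  GRing.isMonoidMorphism.Build B localization to_loc to_loc_is_monoid_morphism.

Lemma to_loc_inj : injective to_loc.
Proof.
move=> x y /(congr1 loc_val) /= /eqP.
by rewrite -subr_eq0 -rmorphB tofrac_eq0 subr_eq0 => /eqP.
Qed.

Lemma to_loc_unit s : S s -> to_loc s \is a GRing.unit.
Proof.
move=> Ss; apply/andP; split; first exact: mult_set_neq0.
apply/loc_predP; exists 1, s; split=> //.
by rewrite rmorph1 div1r.
Qed.

Lemma to_locP (x : localization) :
  exists b s, S s /\ x = to_loc b / to_loc s.
Proof.
have /loc_predP[b [s [Ss xE]]] := valP x.
exists b, s; split=> //; apply: (mulIr (to_loc_unit Ss)).
rewrite divrK ?to_loc_unit//; apply: val_inj.
by rewrite rmorphM /= xE divfK// mult_set_neq0.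
Qed.

End Localization.

(* Main.v *)
Require Import Defs.
From mathcomp Require Import all_boot all_order all_algebra.
From mathcomp Require Import boolp ring.

(* A [k]-derivation [D] of [B] extends to a [k]-derivation [E] of the
   localization, whose degree is attained at some [x] with [x * s = b], [s] in
   [S]. From [E x * s = D b - x * D s] the shift of [E] at [x] is at most the
   larger of the shifts of [D] at [b] and [s]. Those are also shifts of [E], so
   the maximum is already attained at [b] or at [s]. *)

Set Implicit Arguments.
Unset Strict Implicit.
Unset Printing Implicit Defensive.

Import Order.TTheory GRing.Theory.

Local Open Scope ring_scope.

Section OrderedGroup.
Variable G : orderedGroupType.
Implicit Types (a b c : G) (u v w : adjoin_ninf G).

Lemma ogroup_leD2rE c a b : (a + c <= b + c) = (a <= b).
Proof.
apply/idP/idP => [h|]; last exact: ogroup_leD2r.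
by have := ogroup_leD2r (- c) _ _ h; rewrite !addrK.
Qed.

(** A total group order leaves no 2-torsion: adding [a] to both sides of [a <= 0] turns it into
    [0 <= a], so the two are equivalent, and totality gives both. *)
Lemma ogroup_double_eq0 a : a + a = 0 -> a = 0.
Proof.
move=> aa0; have e : (a <= 0) = (0 <= a).
  by rewrite -(ogroup_leD2rE a a 0) aa0 add0r.
by apply: le_anti; have := ogroup_le_total a 0; rewrite e orbb => ->.
Qed.

Lemma le_ninf_anti u v : le_ninf u v -> le_ninf v u -> u = v.
Proof.
by case: u v => [|a] [|b] //= ab ba; congr Fin; apply: le_anti; rewrite ab ba.
Qed.

Lemma le_max_ninf u v w :
  le_ninf u (max_ninf v w) -> le_ninf u v \/ le_ninf u w.
Proof. by rewrite /max_ninf; case: ifP => _; [right | left]. Qed.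

(** Meant for [a] and [b] the degrees of [x] and [s], so that [a + b] is the degree of [x * s]: a
    bound on a numerator times [s] becomes a bound between shifts. *)
Lemma le_add_sub_ninf u v a b :
  le_ninf (add_ninf u (Fin b)) v ->
  le_ninf (sub_ninf u (Fin a)) (sub_ninf v (Fin (a + b))).
Proof.
case: u v => [|c] [|d] //= h.
by rewrite -(ogroup_leD2rE (a + b)) subrK addrA subrK.
Qed.

Lemma sub_add_ninf u a b :
  sub_ninf (add_ninf (Fin a) u) (Fin (a + b)) = sub_ninf u (Fin b).
Proof. by case: u => [|c] //=; rewrite opprD addrACA subrr add0r. Qed.

End OrderedGroup.

Section DegreeFunction.
Variables (B : nzRingType) (G : orderedGroupType) (deg : B -> adjoin_ninf G).
Hypothesis deg_fun : degree_function deg.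

Lemma degree_neq0 x : x != 0 -> exists a, deg x = Fin a.
Proof.
case: deg_fun => deg0 _ _ x0; case E: (deg x) => [|a]; last by exists a.
by move/deg0: E x0 => ->; rewrite eqxx.
Qed.

(** Since [1 * 1 = 1], the degree of [1] is 0; since [(- 1) * (- 1) = 1], that of [- 1] is
    2-torsion, hence 0 as well. *)
Lemma degreeN x : deg (- x) = deg x.
Proof.
have [_ degM _] := deg_fun.
have [a dega] := degree_neq0 (oner_neq0 B).
have [b degb] : exists b, deg (- 1) = Fin b.
  by apply: degree_neq0; rewrite oppr_eq0 oner_neq0.
have a0 : a = 0.
  have := degM 1 1; rewrite mulr1 dega => -[] /eqP.
  by rewrite -subr_eq0 opprD addNKr oppr_eq0 => /eqP.
have b0 : b = 0.
  have := degM (- 1) (- 1); rewrite mulrNN mulr1 degb dega a0 => -[] /esym.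
  exact: ogroup_double_eq0.
by rewrite -mulN1r degM degb b0; case: (deg x) => //= c; rewrite add0r.
Qed.

End DegreeFunction.

Section Extension.
Variables (B : idomainType) (S : mult_set B) (D : B -> B).
Hypothesis D_der : derivation D.

Local Notation i := (@to_loc B S).

(* [E] is specified by the Leibniz rule for every equation [x * s = b], so that
   its properties follow by cancelling denominators. *)
Lemma derivation_extends : exists E : localization S -> localization S,
  forall x b s, S s -> x * i s = i b -> E x * i s + x * i (D s) = i (D b).
Proof.
have [_ DM] := D_der.
suff /boolp.choice[E HE] : forall x, exists e, forall b s, S s ->
    x * i s = i b -> e * i s + x * i (D s) = i (D b) by exists E.
move=> x.
have [b [s [Ss xE]]] := to_locP x.
have xs : x * i s = i b by rewrite xE divrK // to_loc_unit.
(* The witness is the quotient rule for [x = b / s]; it must satisfy the rule for any other fraction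
   [c / t] equal to [x]. *)
exists ((i (D b) - x * i (D s)) / i s) => c t St xt.
(* This is [D] applied to the cross-multiplied equation [b * t = c * s], which holds in [B] by
   injectivity of [i]. *)
have eqD : i (D b) * i t + i b * i (D t) = i (D c) * i s + i c * i (D s).
  rewrite -!rmorphM -!rmorphD -!DM; congr (i (D _)).
  by apply: (@to_loc_inj _ S); rewrite !rmorphM /= -xs -xt mulrAC.
apply: (mulIr (to_loc_unit Ss)).
rewrite mulrDl [_ / _ * i t]mulrAC divrK ?to_loc_unit //.
have -> : (i (D b) - x * i (D s)) * i t + x * i (D t) * i s =
  (i (D b) * i t + (x * i s) * i (D t)) - (x * i t) * i (D s) by ring.
by rewrite xs xt eqD addrK.
Qed.

Section Properties.
Variable E : localization S -> localization S.
Hypothesis E_ext : forall x b s, S s -> x * i s = i b ->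
  E x * i s + x * i (D s) = i (D b).

Lemma extension_to_loc b : E (i b) = i (D b).
Proof.
have [_ DM] := D_der.
have D1 : D 1 = 0.
  by apply/(addrI (D 1)); rewrite addr0 -[RHS](congr1 D (mulr1 1)) DM mulr1 mul1r.
have /E_ext : i b * i 1 = i b by rewrite rmorph1 mulr1.
by move/(_ (mult_set1 S)); rewrite D1 rmorph0 mulr0 addr0 rmorph1 mulr1.
Qed.

(** Over the common denominator [s * t], the rule for [x + y] or [x * y] is compared with those for
    [x] and [y]; then [s * t] is cancelled. *)
Lemma extension_derivation : derivation E.
Proof.
have [DD DM] := D_der.
have frac x : exists b s, S s /\ x * i s = i b.
  have [b [s [Ss ->]]] := to_locP x.
  by exists b, s; rewrite divrK // to_loc_unit.
split=> x y; have [b [s [Ss xs]]] := frac x; have [c [t [St yt]]] := frac y.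
- have Sst := mult_setM Ss St; have Ex := E_ext Ss xs; have Ey := E_ext St yt.
  have xyst : (x + y) * i (s * t) = i (b * t + c * s).
    by rewrite rmorphD !rmorphM /= -xs -yt; ring.
  have := E_ext Sst xyst; rewrite DD !DM !rmorphD !rmorphM /= -Ex -Ey -xs -yt.
  move=> h; apply: (mulIr (to_loc_unit Sst)); rewrite rmorphM /=.
  (* The added term is [(x + y) * i (D (s * t))], which makes the left side that of [h]. *)
  apply: (addIr ((x + y) * (i (D s) * i t + i s * i (D t)))).
  by rewrite h; ring.
- have Sst := mult_setM Ss St; have Ex := E_ext Ss xs; have Ey := E_ext St yt.
  have xyst : x * y * i (s * t) = i (b * c).
    by rewrite !rmorphM /= -xs -yt; ring.
  have := E_ext Sst xyst; rewrite !DM !rmorphD !rmorphM /= -Ex -Ey -xs -yt.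
  move=> h; apply: (mulIr (to_loc_unit Sst)); rewrite rmorphM /=.
  apply: (addIr (x * y * (i (D s) * i t + i s * i (D t)))).
  by rewrite h; ring.
Qed.

End Properties.
End Extension.

Lemma quotient_shift_le (L : idomainType) (G : orderedGroupType)
    (deg : L -> adjoin_ninf G) (E : L -> L) (x s : L) :
  degree_function deg -> derivation E -> x != 0 -> s != 0 ->
  le_ninf (sub_ninf (deg (E x)) (deg x))
          (sub_ninf (deg (E (x * s))) (deg (x * s))) \/
  le_ninf (sub_ninf (deg (E x)) (deg x)) (sub_ninf (deg (E s)) (deg s)).
Proof.
move=> deg_fun [_ EM] x0 s0; have [_ degM degD] := deg_fun.
have [a dega] := degree_neq0 deg_fun x0; have [b degb] := degree_neq0 deg_fun s0.
(* By the Leibniz rule this sum is [E x * s]. *)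
have := degD (E (x * s)) (- (x * E s)).
rewrite degreeN // {1}EM addrK !degM dega degb /=.
case/le_max_ninf => /le_add_sub_ninf h; [left | right]; first exact: h.
(* The degree [a] of [x] cancels between [x * E s] and [x * s]. *)
by rewrite -(sub_add_ninf (deg (E s)) a).
Qed.

Theorem lemma1p8 (k : fieldType) (char0 : [pchar k] =i pred0)
    (B : idomainType) (iota : {rmorphism k -> B}) (S : mult_set B)
    (G : orderedGroupType) (DEG : localization S -> adjoin_ninf G) :
  degree_function DEG ->
  tame_over DEG (@to_loc B S \o iota) ->
  tame_over (DEG \o @to_loc B S) iota.
Proof.
move=> deg_fun tame D [D_der Dk].
have [E E_ext] := derivation_extends S D_der.
have Ei := extension_to_loc D_der E_ext.
have E_der := extension_derivation D_der E_ext.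
have [|d [[x x0 dE] d_max]] := tame E.
  by split=> // a; rewrite /= Ei Dk rmorph0.
have i_neq0 b : b != 0 -> to_loc S b != 0.
  by move=> b0; rewrite -(rmorph0 (@to_loc B S)) (inj_eq (@to_loc_inj B S)).
(* Every shift of [D] is a shift of [E], so [d] bounds them all; only attainment within [B] remains.
   The value [d = NInf] needs no separate case. *)
have shiftD b : b != 0 ->
    le_ninf (sub_ninf (DEG (to_loc S (D b))) (DEG (to_loc S b))) d.
  by move=> b0; apply: d_max; exists (to_loc S b); rewrite ?Ei ?i_neq0.
suff [c c0 dc] : exists2 c : B, c != 0 &
    le_ninf d (sub_ninf (DEG (to_loc S (D c))) (DEG (to_loc S c))).
  exists d; split=> [|u [b b0 ->]]; last exact: shiftD.
  by exists c => //; apply: le_ninf_anti dc (shiftD c c0).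
have [b [s [Ss xE]]] := to_locP x.
have xs : x * to_loc S s = to_loc S b by rewrite xE divrK // to_loc_unit.
have s0 : s != 0 by rewrite -tofrac_eq0 (mult_set_neq0 Ss).
have b0 : b != 0.
  apply: contra_neq (mulf_neq0 x0 (i_neq0 s s0)) => b0.
  by rewrite xs b0 rmorph0.
have := quotient_shift_le deg_fun E_der x0 (i_neq0 s s0).
by rewrite xs !Ei -dE => -[le_d|le_d]; [exists b | exists s].
Qed.
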